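(* Let $P$ be an integral convex polygon in $\mathbb{R}^2$ with edge sequence $\{n_ie_i\}_{1\le i\le m}$ starting at a vertex $v_0$, with $e_i\in\mathbb{Z}^2$ primitive, and let $IP$ be the set of integral points of $P$. Define integer-valued arrays $c_0,\dots,c_m$ indexed by $IP$ as follows: $c_0(v_0)=1$ and $c_0(v)=0$ for $v\in IP\setminus\{v_0\}$; for $1\le i\le m$ and $w\in IP$, $c_i(w)=\sum_{k} c_{i-1}(w-ke_i)$, the sum over all $0\le k\le n_i$ with $w-ke_i\in IP$. Then $c_m(v_0)$ equals the total number of integral summands of $P$, including the trivial ones.
   Context: An integral polytope is a convex polytope whose vertices have integer coordinates; an integral summand of an integral polytope $P$ is an integral polytope $Q$ such that $P=Q+R$ (Minkowski sum $\{q+r:q\in Q,r\in R\}$) for some integral polytope $R$, summands being counted up to translation; the trivial summands are a single point and $P$ itself. For an integral convex polygon $P$ with vertices $v_0,\dots,v_{m-1}$ in clockwise order, the edge vectors are $E_i=v_i-v_{i-1}\in\mathbb{Z}^2$ (indices mod $m$); writing $E_i=n_ie_i$ with $n_i$ the gcd of the coordinates of $E_i$ and $e_i$ a primitive vector (coprime integer coordinates), $\{n_ie_i\}_{1\le i\le m}$ is the edge sequence of $P$. (In the paper, $c_i(w)$ is the first component of the cell $A_i[w]$ computed by the algorithm PolyDecompNum, and the theorem asserts that the integer it outputs, $c_m(v_0)$, is the number of integral summands.) *)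

(* Defs.v *)
From mathcomp Require Import all_boot all_order all_algebra.
From mathcomp Require Import boolp classical_sets functions cardinality reals.

Set Implicit Arguments.
Unset Strict Implicit.
Unset Printing Implicit Defensive.

Import Order.TTheory GRing.Theory Num.Theory.
Local Open Scope classical_set_scope.
Local Open Scope ring_scope.

Notation lattice := 'rV[int]_2.
Notation plane R := 'rV[R]_2.

Definition real_pt {R : realType} (z : lattice) : plane R := map_mx intr z.

Definition hull {R : realType} (k : nat) (p : 'I_k -> plane R) : set (plane R) :=
  [set x | exists a : 'I_k -> R,
     [/\ forall i, 0 <= a i, \sum_(i < k) a i = 1
       & x = \sum_(i < k) a i *: p i]].

(* Points and segments count as (lower-dimensional) polytopes, the empty set
   does not. *)
Definition polytope {R : realType} (P : set (plane R)) : Prop :=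
  exists (k : nat) (p : 'I_k -> plane R), (0 < k)%N /\ P = hull p.

(* A vertex is an extreme point. *)
Definition vertex {R : realType} (P : set (plane R)) (x : plane R) : Prop :=
  P x /\ forall (y z : plane R) (t : R), P y -> P z -> 0 < t < 1 ->
    x = (1 - t) *: y + t *: z -> y = x /\ z = x.

Definition integral_polytope {R : realType} (P : set (plane R)) : Prop :=
  polytope P /\ forall x, vertex P x -> exists z : lattice, x = real_pt z.

Definition integral_points {R : realType} (P : set (plane R)) : set lattice :=
  [set z | P (real_pt z)].

Definition minkowski_sum {R : realType} (A B : set (plane R)) : set (plane R) :=
  [set a + b | a in A & b in B].

Definition integral_summand {R : realType} (P Q : set (plane R)) : Prop :=
  integral_polytope Q /\
  exists S : set (plane R), integral_polytope S /\ P = minkowski_sum Q S.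

Definition translate {R : realType} (t : plane R) (Q : set (plane R)) :
  set (plane R) := [set t + q | q in Q].

Definition summand_class {R : realType} (P Q : set (plane R)) :
  set (set (plane R)) :=
  [set Q' | integral_summand P Q' /\ exists t : plane R, Q' = translate t Q].

(* The quotient of the set of integral summands of P by translation. *)
Definition summand_classes {R : realType} (P : set (plane R)) :
  set (set (set (plane R))) :=
  [set summand_class P Q | Q in integral_summand P].

(* E_i = v_i - v_(i-1) for 1 <= i <= m, with v_m read as v_0. *)
Definition edge (m : nat) (v : nat -> lattice) (i : nat) : lattice :=
  v (i %% m)%N - v i.-1.

Definition cross {R : realType} (a b : plane R) : R :=
  a 0 0 * b 0 1 - a 0 1 * b 0 0.

(* v_0, ..., v_(m-1) lists the vertices of P without repetition in clockwise
   order: P lies weakly to the right of each directed line from v_(i-1) to v_i.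
   A segment (m = 2, traversed back and forth) and a point (m = 1, with zero
   edge vector) are admitted as degenerate polygons. *)
Definition clockwise_vertices {R : realType} (P : set (plane R)) (m : nat)
    (v : nat -> lattice) : Prop :=
  [/\ forall i j, (i < m)%N -> (j < m)%N -> v i = v j -> i = j,
      forall x : plane R,
        vertex P x <-> exists i, (i < m)%N /\ x = real_pt (v i)
    & forall i, (1 <= i <= m)%N -> forall x : plane R, P x ->
        cross (real_pt (edge m v i)) (x - real_pt (v i.-1)) <= 0].

Definition primitive (z : lattice) : Prop := coprimez (z 0 0) (z 0 1).

Definition edge_sequence (m : nat) (v : nat -> lattice) (n : nat -> nat)
    (e : nat -> lattice) : Prop :=
  forall i, (1 <= i <= m)%N ->
    [/\ primitive (e i),
        (n i)%:Z = gcdz (edge m v i 0 0) (edge m v i 0 1)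
      & edge m v i = e i *+ n i].

(* The recursion only visits points of IP; values at w outside IP are junk. *)
Fixpoint cell (IP : set lattice) (v0 : lattice) (n : nat -> nat)
    (e : nat -> lattice) (i : nat) (w : lattice) : int :=
  if i is j.+1 then
    \sum_(0 <= k < (n i).+1 | (w - e i *+ k) \in IP)
       cell IP v0 n e j (w - e i *+ k)
  else if w == v0 then 1 else 0.

(* Main.v *)
(* A summand Q of P, with P = Q + S, has an edge parallel to each edge n_i e_i
   of P (possibly reduced to a point), of lattice length k_i with
   0 <= k_i <= n_i: every vertex of P decomposes uniquely as q_i + s_i, the q_i
   are lattice points of Q, and q_i - q_(i-1) is a multiple of e_i since both
   maximise the same linear functional over Q.  So Q determines (k_i) with
   sum_i k_i e_i = 0, and Q is the hull of the partial sums up to translation,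
   by the cancellation law for Minkowski sums.  Conversely, the partial sums of
   a family (k_i) with zero sum span a summand, whose complement comes from
   (n_i - k_i).  In particular they lie in P when started at v_0, so the
   restriction of the recursion to IP discards no such family, and c_m(v_0)
   counts them all. *)

Require Import Defs.
From mathcomp Require Import all_boot all_order all_algebra.
From mathcomp Require Import boolp classical_sets functions cardinality reals.
From mathcomp Require Import ring lra zify.

Set Implicit Arguments.
Unset Strict Implicit.
Unset Printing Implicit Defensive.

Import Order.TTheory GRing.Theory Num.Theory.
Local Open Scope classical_set_scope.
Local Open Scope ring_scope.

(** * Finitely generated convex sets *)

Section Hull.
Variable R : realType.
Implicit Types (P Q S : set 'rV[R]_2) (x y z : 'rV[R]_2).

Lemma hull_pt (k : nat) (p : 'I_k -> 'rV[R]_2) i : hull p (p i).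
Proof.
exists (fun j => (j == i)%:R); split=> [j||].
- by rewrite ler0n.
- rewrite (bigD1 i) //= eqxx big1 ?addr0 // => j /negbTE ->.
  by [].
- rewrite (bigD1 i) //= eqxx scale1r big1 ?addr0 // => j /negbTE ->.
  by rewrite scale0r.
Qed.

Lemma hull_hull (k l : nat) (p : 'I_k -> 'rV[R]_2) (q : 'I_l -> 'rV[R]_2) :
  (forall i, hull q (p i)) -> hull p `<=` hull q.
Proof.
move=> /choice[b bP] x [a [a0 a1 ->]].
exists (fun j => \sum_i a i * b i j); split=> [j||].
- by apply: sumr_ge0 => i _; apply: mulr_ge0 => //; case: (bP i).
- rewrite exchange_big /= -[RHS]a1; apply: eq_bigr => i _.
  by rewrite -mulr_sumr; case: (bP i) => _ -> _; rewrite mulr1.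
- under [RHS]eq_bigr do rewrite scaler_suml.
  rewrite exchange_big /=; apply: eq_bigr => i _.
  case: (bP i) => _ _ ->; rewrite scaler_sumr.
  by apply: eq_bigr => j _; rewrite scalerA.
Qed.

Lemma hull_segment (k : nat) (p : 'I_k -> 'rV[R]_2) x y (t : R) :
  hull p x -> hull p y -> 0 <= t <= 1 -> hull p ((1 - t) *: x + t *: y).
Proof.
move=> px py /andP[t0 t1].
pose q (i : 'I_2) := if i == ord0 then x else y.
suff : hull q ((1 - t) *: x + t *: y).
  by apply: hull_hull => i; rewrite /q; case: ifP.
exists (fun i => if i == ord0 then 1 - t else t); split.
- by move=> i; case: ifP; rewrite ?subr_ge0.
- by rewrite big_ord_recl big_ord1 /= subrK.
- by rewrite big_ord_recl big_ord1.
Qed.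

Lemma hull_triangle (k : nat) (p : 'I_k -> 'rV[R]_2) x y z (a b c : R) :
  hull p x -> hull p y -> hull p z -> 0 <= a -> 0 <= b -> 0 <= c ->
  a + b + c = 1 -> hull p (a *: x + b *: y + c *: z).
Proof.
move=> px py pz a0 b0 c0 abc.
have : hull (fun i : 'I_3 => nth 0 [:: x; y; z] i) (a *: x + b *: y + c *: z).
  exists (fun i => nth 0 [:: a; b; c] i); split.
  - by case=> [[|[|[|//]]]].
  - by rewrite !big_ord_recr big_ord0 /= add0r.
  - by rewrite !big_ord_recr big_ord0 /= add0r.
by apply: hull_hull; case=> [[|[|[|//]]]].
Qed.

Lemma sum_translate (k : nat) (a : 'I_k -> R) (p : 'I_k -> 'rV[R]_2) x :
  \sum_i a i = 1 -> \sum_i a i *: (x + p i) = x + \sum_i a i *: p i.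
Proof.
move=> a1; under eq_bigr do rewrite scalerDr.
by rewrite big_split /= -scaler_suml a1 scale1r.
Qed.

Lemma minkowski_sum_hull_sub (k l r : nat) (p : 'I_k -> 'rV[R]_2)
    (q : 'I_l -> 'rV[R]_2) (s : 'I_r -> 'rV[R]_2) :
  (forall i j, hull s (p i + q j)) ->
    minkowski_sum (hull p) (hull q) `<=` hull s.
Proof.
move=> spq _ [x [a [a0 a1 xE]] [y [b [b0 b1 yE]] <-]].
have sy i : hull s (p i + y).
  have /hull_hull : forall j, hull s (p i + q j) by [].
  by apply; exists b; split=> //; rewrite yE sum_translate.
have /hull_hull : forall i, hull s (y + p i) by move=> i; rewrite addrC.
by apply; exists a; split=> //; rewrite sum_translate // addrC xE.
Qed.

Lemma hull_sub_minkowski_sum (k : nat) (p q : 'I_k -> 'rV[R]_2) :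
  hull (fun i => p i + q i) `<=` minkowski_sum (hull p) (hull q).
Proof.
move=> x [a [a0 a1 ->]].
exists (\sum_i a i *: p i); first by exists a.
exists (\sum_i a i *: q i); first by exists a.
by rewrite -big_split /=; apply: eq_bigr => i _; rewrite scalerDr.
Qed.

Lemma translate_hull (k : nat) (p : 'I_k -> 'rV[R]_2) x :
  translate x (hull p) = hull (fun i => x + p i).
Proof.
apply/seteqP; split=> [_ [_ [a [a0 a1 ->]] <-]|_ [a [a0 a1 ->]]].
  by exists a; split=> //; rewrite sum_translate.
by exists (\sum_i a i *: p i); [exists a|rewrite sum_translate].
Qed.

(** If [p i] carries positive weight, [x] is [p i] itself or lies strictly between [p i] and the
    normalized combination of the others; extremality gives [x = p i] either way. *)
Lemma vertex_hull (k : nat) (p : 'I_k -> 'rV[R]_2) x :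
  vertex (hull p) x -> exists i, x = p i.
Proof.
move=> [[a [a0 a1 xE]] xext].
have [i ai0] : exists i, 0 < a i.
  apply: contrapT => /forallNP an0.
  suff : \sum_i a i = 0 by rewrite a1 => /eqP; rewrite oner_eq0.
  by apply: big1 => i _; apply/eqP; rewrite eq_le a0 leNgt; apply/andP;
    split=> //; exact/negP.
exists i.
have aiC : \sum_(j | j != i) a j = 1 - a i 
  by apply/eqP; rewrite eq_sym subr_eq -a1 [X in X == _](bigD1 i) //= addrC.
have xE' : x = a i *: p i + \sum_(j | j != i) a j *: p j.
  by rewrite xE (bigD1 i).
have [ai1|ai1] := leP 1 (a i).
  have ai : a i = 1.
    apply/eqP; rewrite eq_le ai1 -subr_ge0 -aiC sumr_ge0 //.
  rewrite xE' ai scale1r big1 ?addr0 // => j ji.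
  have : \sum_(j | j != i) a j == 0 by rewrite aiC ai subrr.
  by rewrite psumr_eq0 // => /allP/(_ j);
    rewrite mem_index_enum ji => /(_ isT)/eqP ->; rewrite scale0r.
have ai'0 : 1 - a i != 0 by rewrite gt_eqF // subr_gt0.
pose y := \sum_(j | j != i) ((1 - a i)^-1 * a j) *: p j.
have py : hull p y.
  exists (fun j => if j == i then 0 else (1 - a i)^-1 * a j); split.
  - by move=> j; case: ifP => // _; rewrite mulr_ge0 // invr_ge0 subr_ge0 ltW.
  - rewrite (bigD1 i) //= eqxx add0r.
    rewrite (eq_bigr (fun j => (1 - a i)^-1 * a j)) => [|j /negbTE-> //].
    by rewrite -mulr_sumr aiC mulVf.
  - rewrite (bigD1 i) //= eqxx scale0r add0r.
    by apply: eq_bigr => j /negbTE ->.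
have [] // := xext y (p i) (a i) py (hull_pt p i); first by rewrite ai0.
rewrite xE' addrC scaler_sumr; congr (_ + _).
by apply: eq_bigr => j _; rewrite scalerA mulrA divff // mul1r.
Qed.

(* A family of generators of minimal size consists of vertices, since a
   generator that is not a vertex is a convex combination of the others. *)
Lemma polytope_hull_vertices P : polytope P ->
  exists (k : nat) (p : 'I_k -> 'rV[R]_2),
    [/\ (0 < k)%N, P = hull p & forall i, vertex P (p i)].
Proof.
move=> Ppoly.
pose A k := `[< exists p : 'I_k -> 'rV[R]_2, (0 < k)%N /\ P = hull p >].
have exA : exists k, A k by case: Ppoly => k [p pP]; exists k; apply/asboolP;
  exists p.
case: (ex_minnP exA) => k /asboolP[p [k0 PE]] kmin.
exists k, p; split=> // i; rewrite PE; split; first exact: hull_pt.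
move=> y z t [a [a0 a1 yE]] [b [b0 b1 zE]] /andP[t0 t1] piE.
pose c j := (1 - t) * a j + t * b j.
have c0 j : 0 <= c j by rewrite addr_ge0 // mulr_ge0 // ltW // subr_gt0.
have c1 : \sum_j c j = 1 by rewrite big_split /= -!mulr_sumr a1 b1 !mulr1 subrK.
have pcE : p i = \sum_j c j *: p j.
  rewrite {1}piE yE zE !scaler_sumr -big_split /=.
  by apply: eq_bigr => j _; rewrite !scalerA -scalerDl.
have all1 (d : 'I_k -> R) w : (forall j, 0 <= d j) -> \sum_j d j = 1 ->
    w = \sum_j d j *: p j -> 1 <= d i -> w = p i.
  move=> d0 d1 -> di1.
  have dC : \sum_(j | j != i) d j == 0.
    rewrite eq_le sumr_ge0 // andbT -(lerD2l (d i)) addr0.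
    by move: d1; rewrite (bigD1 i) //= => ->.
  have di : d i = 1 by move: d1; rewrite (bigD1 i) //= (eqP dC) addr0.
  rewrite (bigD1 i) //= di scale1r big1 ?addr0 // => j ji.
  move: dC; rewrite psumr_eq0 // => /allP/(_ j).
  by rewrite mem_index_enum ji => /(_ isT)/eqP ->; rewrite scale0r.
have le1 (d : 'I_k -> R) : (forall j, 0 <= d j) -> \sum_j d j = 1 -> d i <= 1.
  by move=> d0 <-; rewrite (bigD1 i) //= lerDl sumr_ge0.
have [ci1|ci1] := leP 1 (c i).
  have ai := le1 a a0 a1; have bi := le1 b b0 b1.
  by split; [apply: all1 yE _|apply: all1 zE _] => //; rewrite /c in ci1; nra.
have ci'0 : 1 - c i != 0 by rewrite gt_eqF // subr_gt0.
(* Otherwise [p i] is a convex combination of the other generators, and dropping it contradicts the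
   minimality of their number. *)
exfalso; clearbody c; clear -PE k0 kmin ci1 ci'0 c0 c1 pcE.
case: k p i PE k0 kmin c c0 c1 pcE ci1 ci'0 => [|k] p i PE _ kmin c c0 c1 pcE
  ci1 ci'0 //.
have cE : \sum_j c (lift i j) = 1 - c i.
  by apply/eqP; rewrite eq_sym subr_eq -c1 [X in X == _](bigD1_ord i) //= addrC.
have pE : (1 - c i) *: p i = \sum_j c (lift i j) *: p (lift i j).
  apply/eqP; rewrite scalerBl scale1r subr_eq {1}pcE.
  by rewrite [X in X == _](bigD1_ord i) //= addrC.
have kgt0 : (0 < k)%N.
  case: k p i c cE {PE kmin c0 c1 pcE ci1 pE} ci'0 => // p i c.
  by rewrite big_ord0 => <-; rewrite eqxx.
suff : A k by move=> /kmin; rewrite ltnn.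
apply/asboolP; exists (fun j => p (lift i j)); split=> //.
rewrite PE; apply/seteqP; split; apply: hull_hull => j; last exact: hull_pt.
case: (unliftP i j) => [j' ->|->];
  first exact: (hull_pt (fun j => p (lift i j))).
exists (fun j => (1 - c i)^-1 * c (lift i j)); split.
- by move=> j'; rewrite mulr_ge0 // invr_ge0 subr_ge0 ltW.
- by rewrite -mulr_sumr cE mulVf.
- under eq_bigr do rewrite -scalerA.
  by rewrite -scaler_sumr -pE scalerA mulVf // scale1r.
Qed.

(* The absolute value of a left fixed vector of a stochastic matrix is again
   fixed, because the inequality |x| <= |x| T preserves the sum of entries. *)
Lemma stationary_distribution (k : nat) (T : 'M[R]_k) : (0 < k)%N ->
    (forall i j, 0 <= T i j) -> (forall i, \sum_j T i j = 1) ->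
  exists a : 'I_k -> R, [/\ forall i, 0 <= a i, \sum_i a i = 1
    & forall j, \sum_i a i * T i j = a j].
Proof.
move=> k0 T0 T1.
have : \det (T - 1%:M) == 0.
  (* Unit row sums make the all-ones column a null vector of [T - 1], so a nonzero left null vector
     exists as well. *)
  rewrite -det_tr; apply/det0P; exists (const_mx 1).
    apply/eqP => /rowP/(_ (Ordinal k0)); rewrite !mxE => /eqP.
    by rewrite oner_eq0.
  apply/rowP => j; rewrite !mxE.
  under eq_bigr do rewrite !mxE mul1r.
  rewrite big_split /= T1 (bigD1 j) //= eqxx big1 ?addr0 ?subrr // => i.
  by rewrite eq_sym => /negbTE ->; rewrite oppr0.
move=> /det0P[x x0 xT].
have xE j : x 0 j = \sum_i x 0 i * T i j.
  have /rowP/(_ j) : x *m T = x.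
    by apply/eqP; rewrite -subr_eq0 -[X in _ - X]mulmx1 -mulmxBr xT.
  by rewrite !mxE => <-.
pose s := \sum_j `|x 0 j|.
have s0 : 0 < s.
  rewrite lt_def sumr_ge0 // andbT; apply: contra x0.
  rewrite psumr_eq0 // => /allP x0; apply/eqP/rowP => j; rewrite mxE.
  by apply/eqP; rewrite -normr_eq0; apply: x0; rewrite mem_index_enum.
have xle j : `|x 0 j| <= \sum_i `|x 0 i| * T i j.
  rewrite {1}xE (le_trans (ler_norm_sum _ _ _)) // ler_sum // => i _.
  by rewrite normrM [`|T i j|]ger0_norm.
have xeq j : \sum_i `|x 0 i| * T i j = `|x 0 j|.
  apply/eqP; rewrite -subr_eq0; move: j.
  have : \sum_j (\sum_i `|x 0 i| * T i j - `|x 0 j|) == 0.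
    rewrite big_split /= exchange_big /= sumrN subr_eq0; apply/eqP.
    by apply: eq_bigr => i _; rewrite -mulr_sumr T1 mulr1.
  rewrite psumr_eq0 => [/allP h j|j _]; last by rewrite subr_ge0.
  by apply: h; rewrite mem_index_enum.
exists (fun j => s^-1 * `|x 0 j|); split=> [j||j].
- by rewrite mulr_ge0 // invr_ge0 ltW.
- by rewrite -mulr_sumr mulVf // gt_eqF.
- by rewrite -xeq mulr_sumr; apply: eq_bigr => i _; rewrite mulrA.
Qed.

(* Writing x + b_i as c_i + sum_j T_ij b_j with T stochastic and averaging over
   a stationary distribution of T cancels the b_i. *)
Lemma minkowski_cancel P (k l : nat) (b : 'I_k -> 'rV[R]_2)
    (c : 'I_l -> 'rV[R]_2) : (0 < k)%N ->
  minkowski_sum P (hull b) `<=` minkowski_sum (hull c) (hull b) ->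
  P `<=` hull c.
Proof.
move=> k0 PS x Px.
have /choice[d dP] i : exists y : 'rV[R]_2 * ('I_k -> R), [/\ hull c y.1,
    forall j, 0 <= y.2 j, \sum_j y.2 j = 1 &
    x + b i = y.1 + \sum_j y.2 j *: b j].
  have [|y cy [_ [a [a0 a1 ->]] <-]] := PS (x + b i).
    by exists x => //; exists (b i) => //; exact: hull_pt.
  by exists (y, a).
pose T := \matrix_(i, j) (d i).2 j.
have [i j|i|a [a0 a1 aT]] := @stationary_distribution k T k0.
- by rewrite mxE; case: (dP i).
- by under eq_bigr do rewrite mxE; case: (dP i).
have /hull_hull : forall i, hull c (d i).1 by move=> i; case: (dP i).
apply; exists a; split=> //.
apply: (addIr (\sum_i a i *: b i)).
rewrite -sum_translate //.
transitivity (\sum_i a i *: ((d i).1 + \sum_j (d i).2 j *: b j)).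
  by apply: eq_bigr => i _; case: (dP i) => _ _ _ ->.
under eq_bigr do rewrite scalerDr.
rewrite big_split /=; congr (_ + _).
under eq_bigr do rewrite scaler_sumr.
rewrite exchange_big /=; apply: eq_bigr => j _.
under eq_bigr do rewrite scalerA.
rewrite -scaler_suml -[a j]aT; congr (_ *: _).
by apply: eq_bigr => i _; rewrite mxE.
Qed.

Lemma vertex_hullE P : polytope P -> forall (k : nat) (p : 'I_k -> 'rV[R]_2),
  (forall x, vertex P x <-> exists i, x = p i) -> P = hull p /\ (0 < k)%N.
Proof.
move=> /polytope_hull_vertices[l [q [l0 -> qv]]] k p vp; split.
  apply/seteqP; split; apply: hull_hull => i.
    by have /vp[j ->] := qv i; exact: hull_pt.
  by have [] : vertex (hull q) (p i) by apply/vp; exists i.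
by have /vp[[j jk] _] := qv (Ordinal l0); exact: leq_ltn_trans jk.
Qed.

End Hull.

(** * The cross product and lattice points *)

Section Cross.
Variable R : realType.
Implicit Types (P : set 'rV[R]_2) (a b c d x y z : 'rV[R]_2).

Lemma crossDr a b c : cross a (b + c) = cross a b + cross a c.
Proof. by rewrite /cross !mxE; ring. Qed.

Lemma crossBr a b c : cross a (b - c) = cross a b - cross a c.
Proof. by rewrite /cross !mxE; ring. Qed.

Lemma crossMnr a b k : cross a (b *+ k) = cross a b *+ k.
Proof. by rewrite -!scaler_nat -mulr_natl /cross !mxE; ring. Qed.

Lemma crossMnl a b k : cross (a *+ k) b = cross a b *+ k.
Proof. by rewrite -!scaler_nat -mulr_natl /cross !mxE; ring. Qed.

Lemma crossvv a : cross a a = 0.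
Proof. by rewrite /cross; ring. Qed.

(** Three-term Pluecker relation: it yields the sign of one cross product of four plane vectors from
    the signs of the others. *)
Lemma cross_pluecker x a b d :
  cross x a * cross b d - cross x b * cross a d + cross x d * cross a b = 0.
Proof. by rewrite /cross; ring. Qed.

(** Both sides are twice the signed area of the triangle [x y z]. *)
Lemma cross_rot x y z : cross (y - x) (z - x) = cross (z - y) (x - y).
Proof. by rewrite /cross !mxE; ring. Qed.

Lemma cross_eq0_scale a b : a != 0 -> cross a b = 0 -> exists t : R, b = t *: a.
Proof.
move=> a0 ab.
have [a00|a00] := eqVneq (a 0 0) 0; last first.
  exists (b 0 0 / a 0 0); apply/rowP => i; rewrite mxE.
  case: i => [[|[|//]] i2].
    by rewrite (_ : Ordinal i2 = 0); [field|apply: val_inj].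
  rewrite (_ : Ordinal i2 = 1); last exact: val_inj.
  by apply: (mulfI a00); move/eqP: ab; rewrite subr_eq0 => /eqP ->; field.
have a01 : a 0 1 != 0.
  apply: contra a0 => /eqP a01; apply/eqP/rowP => -[[|[|//]] i2]; rewrite mxE.
    by rewrite (_ : Ordinal i2 = 0) //; exact: val_inj.
  by rewrite (_ : Ordinal i2 = 1) //; exact: val_inj.
have b00 : b 0 0 = 0.
  apply: (mulfI a01); rewrite mulr0; move/eqP: ab.
  by rewrite /cross a00 mul0r sub0r oppr_eq0 => /eqP.
exists (b 0 1 / a 0 1); apply/rowP => i; rewrite mxE.
case: i => [[|[|//]] i2].
  by rewrite (_ : Ordinal i2 = 0); [rewrite a00 b00 mulr0|apply: val_inj].
by rewrite (_ : Ordinal i2 = 1); [field|apply: val_inj].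
Qed.

Lemma cramer a b x : cross a b != 0 ->
  x = (cross x b / cross a b) *: a + (cross a x / cross a b) *: b.
Proof.
move=> ab; apply/rowP => i; rewrite !mxE /cross.
move: ab; rewrite /cross => ab; case: i => [[|[|//]] i2].
  by rewrite (_ : Ordinal i2 = 0); [field|apply: val_inj].
by rewrite (_ : Ordinal i2 = 1); [field|apply: val_inj].
Qed.

(** In [z = x + t (y - x)], the position of [t] relative to 0 and 1 tells which of the three points
    lies strictly between the other two; that one is not extreme. *)
Lemma vertices_not_collinear P x y z : vertex P x -> vertex P y -> vertex P z ->
  x != y -> y != z -> z != x -> cross (y - x) (z - x) != 0.
Proof.
move=> [Px vx] [Py vy] [Pz vz] xy yz zx; apply/eqP.
have yx0 : y - x != 0 by rewrite subr_eq0 eq_sym.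
move=> /(cross_eq0_scale yx0)[t zE].
have {}zE : z = x + t *: (y - x) by rewrite -zE addrC subrK.
have [t0|t0|t0] := ltgtP t 0.
- have t1 : 1 - t != 0 by rewrite gt_eqF // subr_gt0 (lt_trans t0).
  have [] // := vx y z (1 - t)^-1 Py Pz.
  + by rewrite invr_gt0 invf_lt1 subr_gt0 ?(lt_trans t0) // ltrBrDr gtrDl t0.
  + by rewrite zE; apply/rowP => i; rewrite !mxE; field.
  + by move=> yx; rewrite yx eqxx in xy.
- have [t1|t1|t1] := ltgtP t 1.
  + have [] // := vz x y t Px Py.
    * by rewrite t0.
    * by rewrite zE; apply/rowP => i; rewrite !mxE; ring.
    * by move=> xz; rewrite xz eqxx in zx.
  + have [] // := vy x z t^-1 Px Pz.
    * by rewrite invr_gt0 t0 invf_lt1.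
    * by rewrite zE; apply/rowP => i; rewrite !mxE; field; rewrite gt_eqF.
    * by move=> /eqP; rewrite (negbTE xy).
  + by rewrite zE t1 scale1r addrC subrK eqxx in yz.
- by rewrite zE t0 scale0r addr0 eqxx in zx.
Qed.

(** * Integral points and primitive vectors *)

Lemma real_ptD (a b : 'rV[int]_2) :
  real_pt (a + b) = real_pt a + real_pt b :> 'rV[R]_2.
Proof. exact: map_mxD. Qed.

Lemma real_ptB (a b : 'rV[int]_2) :
  real_pt (a - b) = real_pt a - real_pt b :> 'rV[R]_2.
Proof. exact: map_mxB. Qed.

Lemma real_ptMn (a : 'rV[int]_2) k :
  real_pt (a *+ k) = real_pt a *+ k :> 'rV[R]_2.
Proof. exact: raddfMn. Qed.

Lemma real_pt_sum (I : Type) (r : seq I) (F : I -> 'rV[int]_2) :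
  real_pt (\sum_(i <- r) F i) = \sum_(i <- r) real_pt (F i) :> 'rV[R]_2.
Proof. exact: raddf_sum. Qed.

Lemma real_pt_inj : injective (real_pt : 'rV[int]_2 -> 'rV[R]_2).
Proof.
by move=> a b /matrixP ab; apply/matrixP => i j; have := ab i j;
  rewrite !mxE => /intr_inj.
Qed.

Lemma integral_polytope_hull (k : nat) (z : 'I_k -> 'rV[int]_2) : (0 < k)%N ->
  integral_polytope (hull (fun i => real_pt (z i) : 'rV[R]_2)).
Proof.
move=> k0; split; first by exists k, (fun i => real_pt (z i)).
by move=> x /vertex_hull[i ->]; exists (z i).
Qed.

Lemma primitive_neq0 (z : 'rV[int]_2) : primitive z -> z != 0.
Proof. by move=> pz; apply/eqP => z0; move: pz; rewrite z0 /primitive !mxE. Qed.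

Lemma primitive_cross_eq0 (z w : 'rV[int]_2) : primitive z ->
  cross (real_pt z : 'rV[R]_2) (real_pt w) = 0 ->
  exists k : int, w = z *~ k.
Proof.
move=> /coprimezP[[u t] /= ut1] /eqP.
rewrite /cross !mxE -!intrM -intrB intr_eq0 subr_eq0 => /eqP zw.
(* The factor comes from Bezout's identity [u z_0 + t z_1 = 1]. *)
exists (u * w 0 0 + t * w 0 1); rewrite -scaler_int; apply/rowP => i.
rewrite mxE intz -[LHS]mul1r -ut1; apply/eqP; rewrite -subr_eq0; apply/eqP.
case: i => [[|[|//]] i2].
  rewrite (_ : Ordinal i2 = 0); last exact: val_inj.
  rewrite [LHS](_ : _ = t * (z 0 1 * w 0 0 - z 0 0 * w 0 1)); last by ring.
  by rewrite zw subrr mulr0.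
rewrite (_ : Ordinal i2 = 1); last exact: val_inj.
rewrite [LHS](_ : _ = u * (z 0 0 * w 0 1 - z 0 1 * w 0 0)); last by ring.
by rewrite zw subrr mulr0.
Qed.

(** * Ascents and sign changes of finite sequences *)

Lemma ex_ascent (F : nat -> R) l i : (l <= i)%N -> F l < F i ->
  exists2 j, (l <= j < i)%N & F j < F j.+1.
Proof.
elim: i => [|i IH]; first by rewrite leqn0 => /eqP ->; rewrite ltxx.
rewrite leq_eqVlt => /predU1P[->|]; first by rewrite ltxx.
rewrite ltnS => li Fl; have [Fi|Fi] := ltP (F i) (F i.+1).
  by exists i => //; rewrite li ltnSn.
have [|j /andP[lj ji] Fj] := IH li; first exact: lt_le_trans Fi.
by exists j => //; rewrite lj ltnS ltnW.
Qed.

(** Discrete intermediate value property, used to find the sector of a triangle fan that contains a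
    point. *)
Lemma ex_sign_change (g : nat -> R) l i : (l < i)%N -> g l <= 0 -> 0 <= g i ->
  exists2 j, (l <= j < i)%N & g j <= 0 <= g j.+1.
Proof.
elim: i => // i IH; rewrite ltnS leq_eqVlt => /predU1P[<-|li] gl gi.
  by exists l; rewrite ?leqnn ?ltnSn // gl.
have [gi0|/ltW gi0] := leP (g i) 0.
  by exists i; rewrite ?ltnSn ?gi0 // ltnW.
have [j /andP[lj ji] gj] := IH li gl gi0.
by exists j => //; rewrite lj ltnS ltnW.
Qed.

End Cross.

(** * Geometry of the polygon *)

Section Polygon.
Variables (R : realType) (P : set 'rV[R]_2) (m : nat).
Variables (v : nat -> 'rV[int]_2) (n : nat -> nat) (e : nat -> 'rV[int]_2).
Hypothesis P_integral : integral_polytope P.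
Hypothesis v_clockwise : clockwise_vertices P m v.
Hypothesis ne_edges : edge_sequence m v n e.

(* Vertices and edges are indexed by all of [nat], periodically with period [m];
   the edge [i] joins the corners [i] and [i + 1], so it is [e_(i + 1)]. *)
Definition corner i : 'rV[R]_2 := real_pt (v (i %% m)).
Definition edge_dir i : 'rV[R]_2 := real_pt (e (i %% m).+1).
Definition edge_mult i := n (i %% m).+1.

Definition edge_path (k : nat -> nat) i := \sum_(0 <= j < i) edge_dir j *+ k j.

Definition periodic (k : nat -> nat) := forall i, k (i + m)%N = k i.

Lemma corners_generate : P = hull (fun i : 'I_m => corner i) /\ (0 < m)%N.
Proof.
case: v_clockwise => _ vv _; case: P_integral => Ppoly _.
apply: vertex_hullE => // x; rewrite vv; split=> [[i [im ->]]|[i ->]].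
  by exists (Ordinal im); rewrite /corner modn_small.
by exists i; rewrite /corner modn_small.
Qed.

Lemma hull_corners : P = hull (fun i : 'I_m => corner i).
Proof. by case: corners_generate. Qed.

Lemma period_gt0 : (0 < m)%N.
Proof. by case: corners_generate. Qed.

Lemma cornerDm i : corner (i + m) = corner i.
Proof. by rewrite /corner modnDr. Qed.

Lemma edge_dirDm i : edge_dir (i + m) = edge_dir i.
Proof. by rewrite /edge_dir modnDr. Qed.

Lemma vertex_corner i : vertex P (corner i).
Proof.
case: v_clockwise => _ vv _; apply/vv.
by exists (i %% m)%N; rewrite ltn_mod period_gt0.
Qed.

Lemma corner_in i : P (corner i).
Proof. by case: (vertex_corner i). Qed.

Lemma corner_inj i j : (i < j < i + m)%N -> corner i != corner j.
Proof.
move=> /andP[ij jm]; apply/eqP => /real_pt_inj.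
case: v_clockwise => vinj _ _ /vinj.
rewrite !ltn_mod period_gt0 => /(_ isT isT) /eqP.
by rewrite eq_sym eqn_mod_dvd 1?ltnW // => /dvdn_leq; lia.
Qed.

Lemma edgeE i : edge m v (i %% m).+1 = e (i %% m).+1 *+ edge_mult i.
Proof.
have [|_ _ //] := ne_edges (i := (i %% m).+1).
by rewrite ltnS leq0n ltn_mod period_gt0.
Qed.

Lemma cornerS i : corner i.+1 = corner i + edge_dir i *+ edge_mult i.
Proof.
rewrite /edge_dir -real_ptMn -edgeE /edge real_ptB addrC -/(corner i) subrK.
by rewrite /corner -[i.+1]addn1 -modnDml addn1.
Qed.

Lemma cornerB i : corner i.+1 - corner i = edge_dir i *+ edge_mult i.
Proof. by rewrite cornerS addrC addKr. Qed.

Lemma primitive_edge_dir i : primitive (e (i %% m).+1).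
Proof.
have [|//] := ne_edges (i := (i %% m).+1).
by rewrite ltnS leq0n ltn_mod period_gt0.
Qed.

Lemma edge_dir_neq0 i : edge_dir i != 0.
Proof.
apply/eqP => D0; have /primitive_neq0/eqP := primitive_edge_dir i; apply.
by apply: (@real_pt_inj R); rewrite -/(edge_dir i) D0 [RHS]map_mx0.
Qed.

Lemma edge_mult_gt0 i : (1 < m)%N -> (0 < edge_mult i)%N.
Proof.
move=> m1; rewrite lt0n; apply/eqP => nu0.
have := @corner_inj i i.+1; rewrite cornerS nu0 mulr0n addr0 eqxx.
by rewrite ltnSn -addn1 ltn_add2l => /(_ m1).
Qed.

Lemma clockwise i x : P x -> cross (corner i.+1 - corner i) (x - corner i) <= 0.
Proof.
case: v_clockwise => _ _ /(_ (i %% m).+1).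
rewrite ltnS leq0n ltn_mod period_gt0 => /(_ isT x) /=.
rewrite edgeE real_ptMn -/(edge_dir i) -/(corner i) => h /h.
by rewrite cornerB.
Qed.

Lemma cross_edge_dir_le0 i x : (1 < m)%N -> P x ->
  cross (edge_dir i) (x - corner i) <= 0.
Proof.
move=> m1 /(clockwise i); rewrite cornerB crossMnl.
by rewrite pmulrn_lle0 // edge_mult_gt0.
Qed.

(** Clockwise order gives the weak inequality; equality would make three distinct vertices
    collinear. *)
Lemma orient_consecutive i k : (i.+1 < k < i + m)%N ->
  cross (corner i.+1 - corner i) (corner k - corner i) < 0.
Proof.
move=> ikm; rewrite lt_neqAle (clockwise _ (corner_in k)) andbT.
apply: (vertices_not_collinear (P := P)); try exact: vertex_corner.
- by apply: corner_inj; lia.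
- by apply: corner_inj; lia.
- by rewrite eq_sym; apply: corner_inj; lia.
Qed.

(* Seen from the corner [i], all other corners lie on the right of the first
   edge, so the turns from [j] to [k] and from [k] to [k + 1] add up. *)
Lemma orient_lt0 i j k : (i < j < k)%N -> (k < i + m)%N ->
  cross (corner j - corner i) (corner k - corner i) < 0.
Proof.
have next l : (i < l)%N -> (l.+1 < i + m)%N ->
    cross (corner l - corner i) (corner l.+1 - corner i) < 0.
  (* Rotating the triangle makes [l] to [l + 1] the base edge, with the apex read as corner
     [i + m]. *)
  move=> il lm; rewrite cross_rot -[corner i]cornerDm.
  by apply: orient_consecutive; lia.
move=> /andP[ij jk]; elim: k jk => // k IH; rewrite ltnS leq_eqVlt.
move=> /predU1P[<-|jk] km; first exact: next.
have [->|ji] := eqVneq j i.+1; first by apply: orient_consecutive; lia.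
have xj : cross (corner i.+1 - corner i) (corner j - corner i) < 0.
  by apply: orient_consecutive; lia.
have xk : cross (corner i.+1 - corner i) (corner k - corner i) < 0.
  by apply: orient_consecutive; lia.
have xk1 : cross (corner i.+1 - corner i) (corner k.+1 - corner i) < 0.
  by apply: orient_consecutive; lia.
have kk1 := next k (ltn_trans ij jk) km; have jk0 := IH jk (ltnW km).
(* In the Pluecker relation the two outer products are positive, so the middle one is too; hence the
   turn from [j] to [k + 1] is negative. *)
have := cross_pluecker (corner i.+1 - corner i) (corner j - corner i)
  (corner k - corner i) (corner k.+1 - corner i).
nra.
Qed.

(** Triangle fan from corner 0: the sector containing [x] is where the sign of [cross (corner j -
    corner 0) (x - corner 0)] changes, and the half-plane of edge [j] then places [x] in the
    triangle on the corners 0, [j], [j + 1]. *)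
Lemma hull_of_half_planes x : (2 < m)%N ->
  (forall i, cross (edge_dir i) (x - corner i) <= 0) -> P x.
Proof.
move=> m2 xle.
have {}xle i : cross (corner i.+1 - corner i) (x - corner i) <= 0.
  by rewrite cornerB crossMnl mulrn_wle0.
have [|||j /andP[j0 jm] /andP[gj gj1]] :=
    @ex_sign_change R (fun j => cross (corner j - corner 0) (x - corner 0)) 1
      m.-1.
- by lia.
- exact: xle.
- have := xle m.-1; rewrite prednK ?period_gt0 // -[m]add0n cornerDm.
  by rewrite add0n /cross !mxE; lra.
have T0 : cross (corner j - corner 0) (corner j.+1 - corner 0) < 0.
  by apply: orient_lt0; lia.
have gT := xle j.
have gS : cross (corner j.+1 - corner 0) (x - corner 0) -
    cross (corner j - corner 0) (x - corner 0) +
    cross (corner j - corner 0) (corner j.+1 - corner 0) <= 0.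
  by move: gT; rewrite /cross !mxE; lra.
have := cramer (x - corner 0) (ltr0_neq0 T0); move: T0 gj gj1 gS.
set T := cross (corner j - _) (corner j.+1 - _).
rewrite (_ : cross (x - corner 0) _ =
             - cross (corner j.+1 - corner 0) (x - corner 0)); last first.
  by rewrite /cross; ring.
set g := cross (corner j - _) (x - _); set g1 := cross (corner j.+1 - _) _.
move=> T0 gj gj1 gS xE.
(* Barycentric coordinates by Cramer's rule; [gS] makes the weight of corner 0 nonnegative. *)
have -> : x = (1 - (- g1 / T) - (g / T)) *: corner 0 +
    (- g1 / T) *: corner j + (g / T) *: corner j.+1.
  rewrite -[LHS](subrK (corner 0)) xE !scalerBl !scalerBr scale1r.
  by apply/rowP => i; rewrite !mxE; ring.
rewrite hull_corners; apply: hull_triangle.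
- by rewrite -hull_corners; exact: corner_in.
- by rewrite -hull_corners; exact: corner_in.
- by rewrite -hull_corners; exact: corner_in.
- rewrite [leRHS](_ : _ = (g1 - g + T) / T); last by field; rewrite ltr0_neq0.
  by rewrite -mulrNN -invrN mulr_ge0 // ?invr_ge0 oppr_ge0 // ltW.
- by rewrite -mulrNN opprK -invrN mulr_ge0 // invr_ge0 oppr_ge0 ltW.
- by rewrite -mulrNN -invrN mulr_ge0 // ?invr_ge0 oppr_ge0 // ltW.
- by rewrite addrAC subrK subrK.
Qed.

(** * Paths along the edge directions *)

Lemma edge_pathS k i : edge_path k i.+1 = edge_path k i + edge_dir i *+ k i.
Proof. by rewrite /edge_path big_nat_recr. Qed.

Lemma edge_path0 k : edge_path k 0 = 0.
Proof. by rewrite /edge_path big_geq. Qed.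

Lemma edge_path_mod k i : periodic k -> edge_path k m = 0 ->
  edge_path k (i %% m) = edge_path k i.
Proof.
move=> kper km; have step j : edge_path k (j + m) = edge_path k j.
  elim: j => [|j IH]; first by rewrite add0n km edge_path0.
  by rewrite addSn !edge_pathS IH edge_dirDm kper.
rewrite [in RHS](divn_eq i m); elim: (i %/ m)%N => [|q IH];
  first by rewrite mul0n.
by rewrite mulSn -addnA addnC step.
Qed.

(* Over one period starting at [l], the height [cross (edge_dir l)] of the
   corners of [P] first decreases and then increases.  The edges of a closed
   path have the same directions in the same order, so its height behaves
   likewise and is maximal at [l]. *)
Lemma edge_path_cross_le k l i : (1 < m)%N -> periodic k -> edge_path k m = 0 ->
  cross (edge_dir l) (edge_path k i) <= cross (edge_dir l) (edge_path k l).
Proof.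
move=> m1 kper km.
have mod_path j : edge_path k (j + m) = edge_path k j.
  by rewrite -edge_path_mod // modnDr edge_path_mod.
wlog /andP[li im] : i / (l <= i < l + m)%N.
  (* The index is moved into the window starting at [l]; [l * m.-1] stands for [- l] modulo [m]. *)
  move=> wl; pose i' := (l + (i + l * m.-1) %% m)%N.
  have -> : edge_path k i = edge_path k i'.
    rewrite -edge_path_mod // -[RHS]edge_path_mod // /i' modnDmr addnCA -mulnS
      prednK ?period_gt0 //.
    by rewrite [(i + _)%N]addnC modnMDl.
  by apply: wl; rewrite leq_addr ltn_add2l ltn_mod period_gt0.
rewrite leNgt; apply/negP => Fli.
(* If the path were higher at [i] than at [l], it would rise along some edge [j] before [i] and fall
   along some edge [j'] from [i] on. *)
have [j /andP[lj ji] Fj] :=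
  @ex_ascent R (fun j => cross (edge_dir l) (edge_path k j)) l i li Fli.
have [||j' /andP[ij' jm'] Fj'] := @ex_ascent R
    (fun j => - cross (edge_dir l) (edge_path k j)) i (l + m).
- exact: ltnW.
- by rewrite mod_path ltrN2.
have slope a : cross (edge_dir l) (edge_path k a.+1) =
    cross (edge_dir l) (edge_path k a) + cross (edge_dir l) (edge_dir a) *+ k a.
  by rewrite edge_pathS crossDr crossMnr.
have slopeP a : cross (edge_dir l) (corner a.+1) =
    cross (edge_dir l) (corner a) + cross (edge_dir l) (edge_dir a) *+
      edge_mult a.
  by rewrite cornerS crossDr crossMnr.
have top a : cross (edge_dir l) (corner a) <= cross (edge_dir l) (corner l).
  by rewrite -subr_le0 -crossBr; apply: cross_edge_dir_le0 => //;
    exact: corner_in.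
(* The sign of a slope depends only on the edge direction, so [P] rises along [j] and falls along
   [j'] as well. *)
have Gj : cross (edge_dir l) (corner j) < cross (edge_dir l) (corner j.+1).
  rewrite slopeP ltrDl pmulrn_lgt0 ?edge_mult_gt0 // ltNge; apply/negP => Dj.
  by move: Fj; rewrite slope ltrDl ltNge mulrn_wle0.
have Gj' : cross (edge_dir l) (corner j'.+1) < cross (edge_dir l) (corner j').
  rewrite slopeP gtrDl pmulrn_llt0 ?edge_mult_gt0 // ltNge; apply/negP => Dj.
  by move: Fj'; rewrite slope ltrN2 gtrDl ltNge mulrn_wge0.
(* The higher of the corners [j + 1] and [j'] is a peak above both [j] and [j' + 1]. *)
have [M [jM Mj' MB MD]] : exists M, [/\ (j < M)%N, (M < j'.+1)%N,
    cross (edge_dir l) (corner j) < cross (edge_dir l) (corner M) &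
    cross (edge_dir l) (corner j'.+1) < cross (edge_dir l) (corner M)].
  have [le|lt] :=
    leP (cross (edge_dir l) (corner j')) (cross (edge_dir l) (corner j.+1)).
    by exists j.+1; split=> //; [lia|exact: lt_le_trans Gj' le].
  by exists j'; split=> //; [lia|exact: lt_trans lt].
have lj0 : (l < j)%N.
  rewrite ltn_neqAle lj andbT; apply: contraTneq MB => <-.
  by rewrite -leNgt top.
have jm0 : (j'.+1 < l + m)%N.
  rewrite ltn_neqAle jm' andbT; apply: contraTneq MD => ->.
  by rewrite cornerDm -leNgt top.
have BMA : cross (corner M - corner j) (corner l - corner j) < 0.
  by rewrite -[corner l]cornerDm; apply: orient_lt0; lia.
have BMD : cross (corner M - corner j) (corner j'.+1 - corner j) < 0.
  by apply: orient_lt0; lia.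
have MDA : cross (corner j'.+1 - corner M) (corner l - corner M) < 0.
  by rewrite -[corner l]cornerDm; apply: orient_lt0; lia.
(* With [l] on top, the heights of [l], [j], [M], [j' + 1] clash with their clockwise order: the
   left-hand side of the Pluecker relation would be negative. *)
have := cross_pluecker (edge_dir l) (corner M - corner j)
  (corner j'.+1 - corner M)
  (corner l - corner M).
have -> : cross (corner M - corner j) (corner l - corner M) =
    cross (corner M - corner j) (corner l - corner j).
  by rewrite /cross !mxE; ring.
have -> : cross (corner M - corner j) (corner j'.+1 - corner M) =
    cross (corner M - corner j) (corner j'.+1 - corner j).
  by rewrite /cross !mxE; ring.
have := top M; rewrite !(crossBr (edge_dir l)).
nra.
Qed.

(** * Closing families and the summands they span *)

(** These families parametrize the summands up to translation. Periodic functions on [nat] let a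
    path be followed from any corner without reindexing. *)
Definition closing (k : nat -> nat) :=
  [/\ periodic k, edge_path k m = 0 & forall i, (k i <= edge_mult i)%N].

Definition remainder k i := (edge_mult i - k i)%N.

Lemma edge_mult_periodic : periodic edge_mult.
Proof. by move=> i; rewrite /edge_mult modnDr. Qed.

Lemma edge_path_add_remainder k i : (forall i, (k i <= edge_mult i)%N) ->
  edge_path k i + (corner 0 + edge_path (remainder k) i) = corner i.
Proof.
move=> kle; elim: i => [|i IH]; first by rewrite !edge_path0 addr0 add0r.
rewrite !edge_pathS cornerS -IH -[in edge_mult i](subnKC (kle i)) mulrnDr.
by rewrite -[(edge_mult i - k i)%N]/(remainder k i) !addrA; congr (_ + _);
  rewrite -!addrA; congr (_ + _); rewrite addrC -!addrA.
Qed.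

Lemma closing_remainder k : closing k -> closing (remainder k).
Proof.
move=> [kper km kle]; split=> [i||i]; last by rewrite leq_subr.
  by rewrite /remainder kper edge_mult_periodic.
have := edge_path_add_remainder m kle;
  rewrite km add0r -[in corner m](add0n m) cornerDm.
by move/eqP; rewrite -subr_eq0 addrC addKr => /eqP.
Qed.

(** Serves the case [m = 2], where edge 0 is all of [P]. *)
Lemma first_edge_in k : (1 < m)%N -> (k <= edge_mult 0)%N ->
  P (corner 0 + edge_dir 0 *+ k).
Proof.
move=> m1 kle; have mu0 : (edge_mult 0)%:R != 0 :> R
  by rewrite pnatr_eq0 -lt0n edge_mult_gt0.
have -> : corner 0 + edge_dir 0 *+ k =
    (1 - k%:R / (edge_mult 0)%:R) *: corner 0 + (k%:R / (edge_mult 0)%:R) *: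
      corner 1.
  rewrite cornerS -!scaler_nat; apply/rowP => i; rewrite !mxE; field.
  exact: mu0.
rewrite hull_corners; apply: hull_segment.
- by rewrite -hull_corners; exact: corner_in.
- by rewrite -hull_corners; exact: corner_in.
- rewrite divr_ge0 ?ler0n //= ler_pdivrMr ?mul1r ?ler_nat //.
  by rewrite ltr0n edge_mult_gt0.
Qed.

Lemma edge_path_sum_in k i j : closing k ->
  P (edge_path k i + (corner 0 + edge_path (remainder k) j)).
Proof.
move=> kc; have cc := closing_remainder kc.
have [kper km kle] := kc; have [cper cm cle] := cc.
have [m2|m2] := ltnP 2 m.
  have m1 := ltnW m2; apply: hull_of_half_planes => // l.
  rewrite -(edge_path_add_remainder l kle).
  have := edge_path_cross_le l i m1 kper km; have :=
    edge_path_cross_le l j m1 cper cm.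
  rewrite crossBr !crossDr; lra.
(* For [m <= 2] the half-planes do not determine [P]. Modulo [m], the indices either agree, giving a
   corner, or are 0 and 1, giving a point of the segment. *)
rewrite -edge_path_mod // -(edge_path_mod j) //.
move: (ltn_pmod i period_gt0) (ltn_pmod j period_gt0).
set i0 := (i %% m)%N; set j0 := (j %% m)%N => im jm.
have [->|ij] := eqVneq i0 j0; first by rewrite edge_path_add_remainder //;
  exact: corner_in.
have m1 : (1 < m)%N by lia.
have [[-> ->]|[-> ->]] : i0 = 0%N /\ j0 = 1%N \/ i0 = 1%N /\ j0 = 0%N by lia.
  by rewrite edge_path0 add0r edge_pathS edge_path0 add0r; exact: first_edge_in.
by rewrite edge_path0 addr0 edge_pathS edge_path0 add0r addrC;
  exact: first_edge_in.
Qed.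

Definition path_polygon k := hull (fun i : 'I_m => edge_path k i).

(** Equal indices give the corners of [P], hence one inclusion; mixed indices stay in [P], hence the
    other. *)
Lemma path_polygon_add_remainder k : closing k ->
  P = minkowski_sum (path_polygon k)
    (hull (fun i : 'I_m => corner 0 + edge_path (remainder k) i)).
Proof.
move=> kc; have [_ _ kle] := kc; apply/seteqP; split.
  rewrite [X in X `<=` _]hull_corners => x Px; apply: hull_sub_minkowski_sum.
  move: Px; apply: hull_hull => i; rewrite -(edge_path_add_remainder i kle).
  exact: (hull_pt
    (fun i : 'I_m => edge_path k i + (corner 0 + edge_path (remainder k) i))).
rewrite [X in _ `<=` X]hull_corners; apply: minkowski_sum_hull_sub => i j.
by rewrite -hull_corners; exact: edge_path_sum_in.
Qed.

Definition lattice_path (k : nat -> nat) i :=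
  \sum_(0 <= j < i) e (j %% m).+1 *+ k j.

Lemma real_pt_lattice_path k i : real_pt (lattice_path k i) = edge_path k i.
Proof. by rewrite real_pt_sum; apply: eq_bigr => j _; rewrite real_ptMn. Qed.

Lemma path_polygon_summand k : closing k -> integral_summand P (path_polygon k).
Proof.
move=> kc; split.
  rewrite /path_polygon
    (_ : (fun i : 'I_m => edge_path k i) =
    fun i : 'I_m => real_pt (lattice_path k i)).
    by apply: integral_polytope_hull; exact: period_gt0.
  by apply/funext => i; rewrite real_pt_lattice_path.
exists (hull (fun i : 'I_m => corner 0 + edge_path (remainder k) i)); split;
  last exact: path_polygon_add_remainder.
rewrite (_ : (fun i : 'I_m => _) =
             fun i : 'I_m => real_pt
               (v (0 %% m)%N + lattice_path (remainder k) i)).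
  by apply: integral_polytope_hull; exact: period_gt0.
by apply/funext => i; rewrite real_ptD real_pt_lattice_path.
Qed.

(** * From a summand to its closing family *)

(** The vertex [q + s] is the midpoint of [q + s'] and [q' + s], so extremality identifies both with
    it. *)
Lemma vertex_minkowski_unique (Q S : set 'rV[R]_2) q s q' s' :
  P = minkowski_sum Q S -> Q q -> S s -> Q q' -> S s' ->
  vertex P (q + s) -> q + s = q' + s' -> q = q'.
Proof.
move=> PE Qq Ss Qq' Ss' [_ vqs] qs.
have h : 0 < (2^-1 : R) < 1 by apply/andP; split; lra.
have [] // := vqs (q + s') (q' + s) (2^-1) _ _ h.
- by rewrite PE; exists q => //; exists s'.
- by rewrite PE; exists q' => //; exists s.
- transitivity (2^-1 *: ((q + s) + (q' + s'))).
    by rewrite -qs; apply/rowP => i; rewrite !mxE; field.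
  by apply/rowP => i; rewrite !mxE; field.
- by move=> /addrI ss _; move: qs; rewrite ss => /addIr.
Qed.

(** Adding [s] carries a segment of [Q] through [q] to a segment of [P] through [q + s]. *)
Lemma vertex_minkowski_left (Q S : set 'rV[R]_2) q s :
  P = minkowski_sum Q S -> Q q -> S s -> vertex P (q + s) -> vertex Q q.
Proof.
move=> PE Qq Ss [_ vqs]; split=> // y z t Qy Qz t01 qE.
have [] := vqs (y + s) (z + s) t _ _ t01.
- by rewrite PE; exists y => //; exists s.
- by rewrite PE; exists z => //; exists s.
- by rewrite qE; apply/rowP => i; rewrite !mxE; ring.
- by move=> /addIr -> /addIr ->.
Qed.

(** Beyond either end of the edge, a point of [P] on its line would put that end strictly between
    two points of [P]. *)
Lemma edge_line_bounds i (c : R) : (1 < m)%N ->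
  P (corner i + c *: edge_dir i) ->
  0 <= c <= (edge_mult i)%:R.
Proof.
move=> m1 Pc; have mu : 0 < (edge_mult i)%:R :> R
  by rewrite ltr0n edge_mult_gt0.
have cS : corner i.+1 =
  corner i + (edge_mult i)%:R *: edge_dir i by rewrite scaler_nat cornerS.
apply/andP; split; rewrite leNgt; apply/negP => c0.
  have mc0 : 0 < (edge_mult i)%:R - c by rewrite subr_gt0 (lt_trans c0).
  have mc : (edge_mult i)%:R - c != 0 by rewrite gt_eqF.
  have [_ /(_ _ _ (- c / ((edge_mult i)%:R - c)) Pc (corner_in i.+1))] :=
    vertex_corner i.
  case.
  - by rewrite (ltr_pdivrMr _ _ mc0) mul1r ltrDr mu andbT divr_gt0 ?oppr_gt0.
  - by rewrite cS; apply/rowP => j; rewrite !mxE; field.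
  - move=> /eqP; rewrite -subr_eq0 addrC addKr scaler_eq0
    (negbTE (edge_dir_neq0 i)).
    by rewrite orbF => /eqP c00; rewrite c00 ltxx in c0.
have cgt0 := lt_trans mu c0.
have [_ /(_ _ _ ((edge_mult i)%:R / c) (corner_in i) Pc)] := vertex_corner i.+1.
case.
- by rewrite (ltr_pdivrMr _ _ cgt0) mul1r c0 andbT divr_gt0.
- by rewrite cS; apply/rowP => j; rewrite !mxE; field; rewrite gt_eqF.
- move=> /eqP; rewrite (negbTE (@corner_inj i i.+1 _)) //.
  by rewrite ltnSn -addn1 ltn_add2l.
Qed.

Lemma summand_path_polygon Q : integral_summand P Q ->
  exists k t, closing k /\ Q = translate t (path_polygon k).
Proof.
move=> [[Qpoly Qint] [S [[[r [b [r0 SE]]] Sint] PE]]].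
have /choice[qs qsP] i : exists x : 'rV[R]_2 * 'rV[R]_2,
    [/\ Q x.1, S x.2 & x.1 + x.2 = corner i].
  have : P (corner i) := corner_in i.
  by rewrite PE => -[x Qx [y Sy xy]]; exists (x, y).
pose q i := (qs i).1; pose s i := (qs i).2.
have Qq i : Q (q i) by case: (qsP i).
have Ss i : S (s i) by case: (qsP i).
have qsE i : q i + s i = corner i by case: (qsP i).
have vqs i : vertex P (q i + s i) by rewrite qsE; exact: vertex_corner.
(* Uniqueness of the decomposition makes [q] periodic, although the pairs [qs i] were chosen
   freely. *)
have qm i : q (i + m)%N = q i.
  apply: (vertex_minkowski_unique PE _ (Ss (i + m)%N) _ (Ss i)) => //.
  by rewrite !qsE cornerDm.
have /choice[z zE] i : exists z : 'rV[int]_2, q i = real_pt z.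
  exact/Qint/(vertex_minkowski_left PE (Qq i) (Ss i)).
have Pqs i j : P (q i + s j) by rewrite PE; exists (q i) => //; exists (s j).
have /choice[k kP] i : exists k, (k <= edge_mult i)%N /\ q i.+1 =
  q i + edge_dir i *+ k.
  have [m1|m1] := leqP m 1.
    exists 0%N; split=> //; rewrite addr0 -[in RHS]qm.
    by congr q; have := period_gt0; lia.
  (* The mixed sums are at most as high as the line of edge [i], and the unmixed ones lie on it, so
     [q i] and [q i.+1] have equal height. *)
  have le1 := cross_edge_dir_le0 i m1 (Pqs i.+1 i).
  have le2 := cross_edge_dir_le0 i m1 (Pqs i i.+1).
  have cq : cross (edge_dir i) (q i.+1 - q i) = 0.
    have e1 : cross (edge_dir i) (q i + s i) =
      cross (edge_dir i) (corner i) by rewrite qsE.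
    have : cross (edge_dir i) (q i.+1 + s i.+1) = cross (edge_dir i) (corner i).
      by rewrite qsE cornerS crossDr crossMnr crossvv mul0rn addr0.
    move: le1 le2 e1; rewrite !crossBr !crossDr; lra.
  have [c cE] : exists c : int, z i.+1 - z i = e (i %% m).+1 *~ c.
    apply: (@primitive_cross_eq0 R); first exact: primitive_edge_dir.
    by rewrite real_ptB -!zE.
  have {}cE : q i.+1 = q i + c%:~R *: edge_dir i.
    rewrite -[LHS](subrK (q i)) addrC; congr (_ + _).
    rewrite !zE -real_ptB cE scaler_int; apply: raddfMz.
  (* This point is [q i.+1 + s i]; being in [P] on the line of edge [i], it bounds [c] by 0 and
     [edge_mult i]. *)
  have : P (corner i + c%:~R *: edge_dir i) by rewrite -qsE addrAC -cE.
  move=> /(edge_line_bounds m1)/andP[].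
  rewrite ler0z pmulrn ler_int; case: c cE => // c cE _ cle.
  by exists c; split=> //; rewrite cE -scaler_nat.
have pathE i : q i = q 0%N + edge_path k i.
  elim: i => [|i IH]; first by rewrite edge_path0 addr0.
  by have [_ ->] := kP i; rewrite IH edge_pathS addrA.
have kc : closing k.
  split=> [i||i]; last by case: (kP i).
  - have [_] := kP (i + m)%N; have [_] := kP i.
    rewrite -addSn !qm => -> /addrI/eqP; rewrite edge_dirDm -!scaler_nat.
    rewrite -subr_eq0 -scalerBl scaler_eq0 (negbTE (edge_dir_neq0 i)) orbF
      subr_eq0.
    by rewrite eqr_nat => /eqP.
  - by have := pathE m; rewrite -[in q m](add0n m) qm -[LHS]addr0 => /addrI.
exists k, (q 0%N); split=> //; rewrite /path_polygon translate_hull.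
rewrite (_ : (fun i : 'I_m => _) = fun i : 'I_m => q i); last first.
  by apply/funext => i; rewrite [in RHS]pathE.
apply/seteqP; split; last first.
  by case: Qpoly => l [p [_ QE]]; rewrite QE; apply: hull_hull => i;
    rewrite -QE.
(* Every corner of [P] is some [q i + s i], so [P] lies in the hull of the [q i] plus [S];
   cancelling [S] puts [Q] in that hull. *)
apply: (minkowski_cancel (b := b) r0); rewrite -SE -PE.
rewrite [X in X `<=` _]hull_corners => x Px.
have [y qy [w sw <-]] : minkowski_sum (hull (fun i : 'I_m => q i))
    (hull (fun i : 'I_m => s i)) x.
  apply: hull_sub_minkowski_sum; move: Px; apply: hull_hull => i.
  by rewrite -qsE; exact: (hull_pt (fun i : 'I_m => q i + s i)).
exists y => //; exists w => //; rewrite SE; move: sw; apply: hull_hull => i.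
by rewrite -SE.
Qed.

(** Cancellation carries the translation over to the complements, which gives each corner a second
    decomposition with first term [t + edge_path k' i]. Its uniqueness equates the paths up to [t],
    and consecutive differences recover the multiplicities. *)
Lemma path_polygon_translate_inj k k' t : closing k -> closing k' ->
  path_polygon k = translate t (path_polygon k') -> k =1 k'.
Proof.
move=> kc kc' kk'; have [kper km kle] := kc; have [kper' km' kle'] := kc'.
pose s i := corner 0 + edge_path (remainder k) i; pose s' i :=
  corner 0 + edge_path (remainder k') i.
have PE : P = minkowski_sum (path_polygon k) (hull (fun i : 'I_m => s i)).
  exact: path_polygon_add_remainder.
have PE' : P = minkowski_sum (path_polygon k') (hull (fun i : 'I_m => s' i)).
  exact: path_polygon_add_remainder.
have sub : hull (fun i : 'I_m => s' i) `<=` hull (fun i : 'I_m => t + s i).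
  apply: (minkowski_cancel (b := fun i : 'I_m => edge_path k' i) period_gt0).
  move=> _ [x s'x [y ky <-]].
  have : P (y + x) by rewrite PE'; exists y => //; exists x.
  rewrite PE kk' => -[_ [w kw <-] [u su wu]].
  exists (t + u); first by rewrite -translate_hull; exists u.
  by exists w => //; rewrite [x + y]addrC -wu addrAC.
have pathk i : edge_path k i = t + edge_path k' i.
  have ord j : exists o : 'I_m, (o : nat) = (j %% m)%N.
    by exists (Ordinal (ltn_pmod j period_gt0)).
  have [o oi] := ord i; rewrite -edge_path_mod // -[in RHS]edge_path_mod // -oi.
  have := hull_pt (fun i : 'I_m => s' i) o => /sub.
  rewrite -translate_hull => -[u su us].
  apply: (vertex_minkowski_unique PE (s := s o) (s' := u)) => //.
  - exact: (hull_pt (fun i : 'I_m => edge_path k i)).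
  - exact: (hull_pt (fun i : 'I_m => s i)).
  - by rewrite kk'; exists (edge_path k' o) => //;
    exact: (hull_pt (fun i : 'I_m => edge_path k' i)).
  - by rewrite edge_path_add_remainder //; exact: vertex_corner.
  - by rewrite edge_path_add_remainder // addrAC us addrC
    edge_path_add_remainder.
move=> i; have := pathk i.+1; rewrite !edge_pathS pathk addrA => /addrI/eqP.
rewrite -!scaler_nat -subr_eq0 -scalerBl scaler_eq0 (negbTE (edge_dir_neq0 i))
  orbF.
by rewrite subr_eq0 eqr_nat => /eqP.
Qed.

End Polygon.
(** * Counting *)

Section Walks.
Variables (IP : set 'rV[int]_2) (v0 : 'rV[int]_2) (n : nat -> nat).
Variable e : nat -> 'rV[int]_2.

(** Lists the multiplicities of the walks that [cell] counts, by the same recursion; [rcons] keeps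
    the order of the edges. *)
Fixpoint walks i w : seq (seq nat) :=
  if i is j.+1 then
    [seq rcons s k | k <- [seq k <- iota 0 (n i).+1 | (w - e i *+ k) \in IP],
                     s <- walks j (w - e i *+ k)]
  else if w == v0 then [:: [::]] else [::].

Lemma walksS i w : walks i.+1 w =
  [seq rcons s k |
    k <- [seq k <- iota 0 (n i.+1).+1 | (w - e i.+1 *+ k) \in IP],
                   s <- walks i (w - e i.+1 *+ k)].
Proof. by []. Qed.

Lemma cell_walks i w : cell IP v0 n e i w = (size (walks i w))%:Z.
Proof.
elim: i w => [|i IH] w; first by rewrite /=; case: ifP.
rewrite walksS size_allpairs_dep sumnE big_map big_filter
  (big_morph Posz PoszD erefl).
by rewrite [LHS]/cell -/cell /index_iota subn0; apply: eq_bigr => k _;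
  rewrite IH.
Qed.

Lemma walks_uniq i w : uniq (walks i w).
Proof.
elim: i w => [|i IH] w; first by rewrite /=; case: ifP.
rewrite walksS; apply: allpairs_uniq_dep;
  first by rewrite filter_uniq // iota_uniq.
  by move=> k _; exact: IH.
by move=> [k s] [k' s'] _ _ /= /rcons_inj[-> ->].
Qed.

Definition walk_pos (s : seq nat) i :=
  v0 + \sum_(0 <= j < i) e j.+1 *+ nth 0%N s j.

Lemma walk_pos_rcons s k i : (i <= size s)%N ->
  walk_pos (rcons s k) i = walk_pos s i.
Proof.
move=> si; congr (_ + _); apply: eq_big_nat => j /andP[_ ji].
by rewrite nth_rcons (leq_trans ji si).
Qed.

(** Positions are tested for [j < i] only: the recursion tests [w - e i *+ k] but never the endpoint
    [w]. *)
Lemma walksP i w s : reflect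
  [/\ size s = i, w = walk_pos s i
    & forall j, (j < i)%N -> (nth 0 s j <= n j.+1)%N /\ IP (walk_pos s j)]
  (s \in walks i w).
Proof.
apply: (iffP idP).
- elim: i w s => [|i IH] w s.
    rewrite /=; case: eqP => // ->; rewrite inE => /eqP ->; split=> //.
    by rewrite /walk_pos big_geq // addr0.
  rewrite walksS => /allpairsPdep[k [{}s [+ /IH[ss wE sP] ->]]].
  rewrite mem_filter mem_iota leq0n add0n ltnS => /andP[/set_mem wIP kn].
  have spos : walk_pos (rcons s k) i = w - e i.+1 *+ k.
    by rewrite walk_pos_rcons ?ss.
  split=> [||j]; first by rewrite size_rcons ss.
    rewrite /walk_pos big_nat_recr //= addrA -/(walk_pos _ _) spos.
    by rewrite nth_rcons ss ltnn eqxx subrK.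
  rewrite ltnS leq_eqVlt => /predU1P[->|ji].
    by rewrite nth_rcons ss ltnn eqxx spos.
  by rewrite nth_rcons ss ji walk_pos_rcons ?ss ?(ltnW ji) //; exact: sP.
- elim: i w s => [|i IH] w s [].
    by move=> /size0nil -> -> _; rewrite /walk_pos big_geq // addr0 /= eqxx.
  case/lastP: s => // s k; rewrite size_rcons => -[ss] wE sP.
  have wE' : w - e i.+1 *+ k = walk_pos s i.
    rewrite wE /walk_pos big_nat_recr //= addrA -/(walk_pos _ _).
    by rewrite nth_rcons ss ltnn eqxx addrK walk_pos_rcons ?ss.
  have [kn kIP] := sP i (ltnSn i).
  move: kn kIP; rewrite nth_rcons ss ltnn eqxx walk_pos_rcons ?ss // => kn kIP.
  rewrite walksS; apply/allpairsPdep; exists k, s; split=> //.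
    by rewrite mem_filter mem_iota leq0n add0n ltnS kn !andbT wE';
      apply: mem_set.
  apply: IH; split=> // j ji; have [] := sP j (ltnW ji).
  by rewrite nth_rcons ss ji walk_pos_rcons ?ss // ltnW.
Qed.

End Walks.

(** * Bijection between closed walks and summand classes *)

Section Count.
Variables (R : realType) (P : set 'rV[R]_2) (m : nat).
Variables (v : nat -> 'rV[int]_2) (n : nat -> nat) (e : nat -> 'rV[int]_2).
Hypothesis P_integral : integral_polytope P.
Hypothesis v_clockwise : clockwise_vertices P m v.
Hypothesis ne_edges : edge_sequence m v n e.

Definition lengths (s : seq nat) i := nth 0%N s (i %% m).

Lemma walk_pos_edge_path s i : (i <= m)%N ->
  real_pt (walk_pos (v 0%N) e s i) =
    corner R m v 0 + edge_path R m e (lengths s) i.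
Proof.
move=> im; rewrite real_ptD /corner mod0n real_pt_sum; congr (_ + _).
apply: eq_big_nat => j /andP[_ ji].
by rewrite real_ptMn /edge_dir /lengths modn_small // (leq_trans ji).
Qed.

Lemma mem_walks s :
  s \in walks (integral_points P) (v 0%N) n e m (v 0%N) <->
  size s = m /\ closing R m n e (lengths s).
Proof.
have m0 := period_gt0 P_integral v_clockwise.
split.
  move=> /walksP[ss posm sP]; split=> //; split.
  - by move=> i; rewrite /lengths modnDr.
  - apply: (addrI (corner R m v 0)).
    by rewrite -walk_pos_edge_path // -posm addr0 /corner mod0n.
  - by move=> i; have [|] := sP (i %% m)%N; first exact: ltn_pmod.
move=> [ss sc]; have [_ pm le] := sc; apply/walksP; split=> //.
  apply: (@real_pt_inj R); rewrite walk_pos_edge_path // pm addr0.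
  by rewrite /corner mod0n.
move=> j jm; split.
  by have := le j; rewrite /lengths /edge_mult modn_small.
rewrite /integral_points /= walk_pos_edge_path 1?ltnW //.
(* The second index 0 reduces the complementary path to corner 0, so the walk itself stays in
   [P]. *)
have := edge_path_sum_in P_integral v_clockwise ne_edges j 0
  sc.
by rewrite edge_path0 addr0 addrC.
Qed.

Lemma summand_classE (Q : set 'rV[R]_2) t :
  summand_class P (translate t Q) = summand_class P Q.
Proof.
apply/seteqP; split=> Q' [Q'P [u Q'E]]; split=> //; rewrite {}Q'E {Q'P}.
  exists (u + t); apply/seteqP; split.
    by move=> _ [_ [x Qx <-] <-]; exists x => //; rewrite addrA.
  by move=> _ [x Qx <-]; exists (t + x); [exists x|rewrite addrA].
exists (u - t); apply/seteqP; split.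
  by move=> _ [x Qx <-]; exists (t + x); [exists x|rewrite addrA subrK].
by move=> _ [_ [x Qx <-] <-]; exists x => //; rewrite addrA subrK.
Qed.

Lemma summand_classesE : summand_classes P =
  (fun s => summand_class P (path_polygon m e (lengths s))) @`
    [set` walks (integral_points P) (v 0%N) n e m (v 0%N)].
Proof.
have m0 := period_gt0 P_integral v_clockwise.
apply/seteqP; split=> [_ [Q QP <-]|_ [s /mem_walks[ss sc] <-]]; last first.
  by exists (path_polygon m e (lengths s)) => //;
    exact: (path_polygon_summand P_integral v_clockwise ne_edges).
have [k [t [kc ->]]] := summand_path_polygon P_integral v_clockwise ne_edges QP.
have kE : lengths (mkseq k m) = k.
  apply/funext => i; rewrite /lengths nth_mkseq ?ltn_pmod //.
  have [kper _ _] := kc; rewrite [in RHS](divn_eq i m).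
  elim: (i %/ m)%N => [|q IH]; first by rewrite mul0n.
  by rewrite mulSn -addnA addnC kper.
exists (mkseq k m) => /=; last by rewrite kE summand_classE.
by apply/mem_walks; rewrite size_mkseq kE.
Qed.

Lemma summand_class_inj :
  {in [set` walks (integral_points P) (v 0%N) n e m (v 0%N)] &,
  injective (fun s => summand_class P (path_polygon m e (lengths s)))}.
Proof.
move=> s s' /set_mem/mem_walks[ss sc] /set_mem/mem_walks[ss' sc'] /= eqc.
(* Each class contains its own representative, so equality of classes makes the two polygons
   translates. *)
have : summand_class P (path_polygon m e (lengths s))
  (path_polygon m e (lengths s)).
  split; first exact: (path_polygon_summand P_integral v_clockwise ne_edges).
  exists 0; apply/seteqP; split=> [x Qx|_ [x Qx <-]]; last by rewrite add0r.
  by exists x => //; rewrite add0r.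
rewrite eqc => -[_
  [t /(path_polygon_translate_inj P_integral v_clockwise ne_edges sc sc') ll]].
apply: (@eq_from_nth _ 0%N) => [|i im]; first by rewrite ss.
by have := ll i; rewrite /lengths modn_small // -ss.
Qed.

End Count.

Lemma card_eq_uniq (T : eqType) (s : seq T) : uniq s ->
  ([set` s] #= `I_(size s))%card.
Proof.
case: s => [|x s] us; first by rewrite II0 set_nil.
have -> : [set` x :: s] = nth x (x :: s) @` `I_(size (x :: s)).
  apply/seteqP; split=> [y /= ys|_ [i /= im <-]]; last exact: mem_nth.
  exists (index y (x :: s)); last exact: nth_index.
  by move: ys; rewrite -index_mem.
apply: inj_card_eq => i j /set_mem /= im /set_mem /= jm /eqP.
by rewrite nth_uniq // => /eqP.
Qed.

Theorem theorem14 (R : realType) (P : set 'rV[R]_2) (m : nat)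
    (v : nat -> 'rV[int]_2) (n : nat -> nat) (e : nat -> 'rV[int]_2)
    (P_integral : integral_polytope P)
    (v_clockwise : clockwise_vertices P m v)
    (ne_edges : edge_sequence m v n e) :
  exists N : nat,
    (summand_classes P #= `I_N)%card /\
    cell (integral_points P) (v 0%N) n e m (v 0%N) = N%:Z.
Proof.
exists (size (walks (integral_points P) (v 0%N) n e m (v 0%N))).
split; last exact: cell_walks.
rewrite (summand_classesE P_integral v_clockwise ne_edges).
apply: card_eq_trans (card_eq_uniq (walks_uniq _ _ _ _ _ _)).
exact/inj_card_eq/summand_class_inj.
Qed.
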